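(* Let $k\ge 1$ and let $V$ be a finite-dimensional complex vector space. The algebra $\mathrm{End}_{SL(V)}S^{k}_{0}\mathfrak{sl}(V)$ is isomorphic to the centre of the group algebra $\mathbb{C}[\mathfrak{S}_{k}]$.
   Context: $\mathfrak{S}_k$ is the symmetric group on $k$ letters. $\mathfrak{gl}(V)\cong V\otimes V^*$, and $\mathfrak{sl}(V)$ is its trace-free part. $S^k_0\mathfrak{sl}(V)$ is the totally trace-free part of the $k$-th symmetric power of $\mathfrak{sl}(V)$: the subspace of those elements of $S^k\mathfrak{sl}(V)\subset(\bigotimes^kV)\otimes(\bigotimes^kV^* )$ for which every contraction of a $V$-index with a $V^*$-index vanishes. $\mathrm{End}_{SL(V)}$ denotes the algebra of linear endomorphisms commuting with the natural action of $SL(V)$.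
   Formalization: The formal theorem adds the hypothesis 2k ≤ dim V; without it the claim is false (for k = 1, dim V = 1 the space is 0 but the centre is C), and it holds exactly under this bound. *)

(* Defs.v *)
From HB Require Import structures.
From mathcomp Require Import all_boot all_order all_algebra all_fingroup.
From mathcomp Require Import mxrepresentation complex.
From mathcomp Require Import boolp classical_sets functions reals.

Set Implicit Arguments.
Unset Strict Implicit.
Unset Printing Implicit Defensive.

Import GRing.Theory passmx.
Local Open Scope classical_set_scope.
Local Open Scope ring_scope.

Section LinearAlgebra.
Variables (F : fieldType) (V : vectType F).

Definition end_mx (A : 'End(V)) : 'M[F]_(\dim {:V}) :=
  mxof (vbasis {:V}) (vbasis {:V}) A.

Definition end_trace (A : 'End(V)) : F := \tr (end_mx A).

Definition end_det (A : 'End(V)) : F := \det (end_mx A).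

Definition dualV := 'Hom(V, F^o).

Definition dual_basis (a : 'I_(\dim {:V})) : dualV :=
  linfun (coord (vbasis {:V}) a : V -> F^o).

Definition SL := {g : 'End(V) | end_det g == 1}.

Lemma vbasis_fullvP : basis_of {:V} (vbasis {:V}).
Proof. exact: vbasisP. Qed.

Lemma end_mx_comp (A B : 'End(V)) : end_mx (A \o B)%VF = end_mx B *m end_mx A.
Proof. by apply: mxof_comp; exact: vbasis_fullvP. Qed.

Lemma end_mx1 : end_mx (\1%VF : 'End(V)) = 1%:M.
Proof. by apply: mxof1; exact: basis_free vbasis_fullvP. Qed.

Lemma SL_lker0 (g : SL) : lker (val g) == 0%VS.
Proof.
have gU : end_mx (val g) \in unitmx.
  by rewrite unitmxE; have := valP g; rewrite /end_det => /eqP ->; exact: unitr1.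
apply/lker0P => u v guv; apply: (can_inj (rVofK vbasis_fullvP)).
apply: (can_inj (mulmxK gU)).
by rewrite /end_mx -!(rVof_app _ vbasis_fullvP) guv.
Qed.

Lemma end_trace_conj (g : SL) (A : 'End(V)) :
  end_trace (val g \o A \o (val g)^-1)%VF = end_trace A.
Proof.
rewrite /end_trace !end_mx_comp mulmxA mxtrace_mulC mulmxA -end_mx_comp.
by rewrite lker0_compVf ?SL_lker0// end_mx1 mul1mx.
Qed.

Lemma dual_basisE a u : dual_basis a u = coord (vbasis {:V}) a u.
Proof. by rewrite lfunE. Qed.

End LinearAlgebra.

Section Tensors.
Variables (F : fieldType) (V : vectType F) (k : nat).

(* (V^{⊗k}) ⊗ (V*^{⊗k}) is viewed inside the functions of k covectors and     *)
(* k vectors: the covectors fill the V-slots and the vectors the V*-slots.    *)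
Definition tensor := ('I_k -> dualV V) -> ('I_k -> V) -> F^o.

(* A_0 ⊗ ... ⊗ A_(k-1), where gl(V) is identified with V ⊗ V* by letting      *)
(* A : 'End(V) stand for the bilinear form (alpha, v) |-> alpha (A v).        *)
Definition endtens (A : 'I_k -> 'End(V)) : tensor :=
  fun alpha v => \prod_i alpha i (A i (v i)).

Definition tens_sl : set tensor :=
  [set T | exists m (c : 'I_m -> F) (A : 'I_m -> 'I_k -> 'End(V)),
     (forall j i, end_trace (A j i) = 0) /\
     T = \sum_(j < m) c j *: endtens (A j)].

(* In characteristic 0 the symmetric power S^k sl(V) is the space of          *)
(* symmetric tensors in the k-th tensor power of sl(V); on mixed tensors, s   *)
(* permutes the pairs (i-th V-index, i-th V*-index).                          *)
Definition sym_sl : set tensor :=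
  [set T | tens_sl T /\
     forall (s : 'S_k) alpha v, T (alpha \o s) (v \o s) = T alpha v].

(* Contraction of the p-th V-index with the q-th V*-index; the values         *)
(* alpha p and v q are ignored.                                               *)
Definition contraction (p q : 'I_k) (T : tensor) : tensor :=
  fun alpha v => \sum_(a < \dim {:V})
    T (fun i => if i == p then dual_basis a else alpha i)
      (fun i => if i == q then (vbasis {:V})`_a else v i).

Definition sym0_sl : set tensor :=
  [set T | sym_sl T /\ forall p q, contraction p q T = 0].

(* (g T)(alpha, v) = T (alpha \o g, g^-1 v), i.e. the natural action, which   *)
(* maps endtens A to endtens (g A g^-1).                                      *)
Definition tens_act (g : 'End(V)) (T : tensor) : tensor :=
  fun alpha v => T (fun i => (alpha i \o g)%VF) (fun i => (g^-1)%VF (v i)).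

Lemma tens_sl_subsemimod :
  (forall c T, tens_sl T -> tens_sl (c *: T)) /\
  (tens_sl 0 /\ forall S T, tens_sl S -> tens_sl T -> tens_sl (S + T)).
Proof.
split; [|split].
- move=> d _ [m [c [A [A0 ->]]]]; exists m, (fun j => d * c j), A; split => //.
  by rewrite scaler_sumr; apply: eq_bigr => j _; rewrite scalerA.
- exists 0%N, (fun=> 0), (fun _ _ => 0); split; last by rewrite big_ord0.
  by move=> [].
- move=> _ _ [m [c [A [A0 ->]]]] [n [d [B [B0 ->]]]].
  exists (m + n)%N,
    (fun j : 'I_(m + n) => match fintype.split j with inl i => c i | inr i => d i end),
    (fun j : 'I_(m + n) => match fintype.split j with inl i => A i | inr i => B i end).
  split; first by move=> j i; case: (fintype.split j).
  rewrite big_split_ord /=; congr (_ + _); apply: eq_bigr => j _.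
    by rewrite (unsplitK (inl j : 'I_m + 'I_n)).
  by rewrite (unsplitK (inr j : 'I_m + 'I_n)).
Qed.

Lemma sym0_sl_subsemimod : subsemimod_closed [pred T | `[< sym0_sl T >]].
Proof.
have [scl [cl0 addcl]] := tens_sl_subsemimod; split; [split|].
- apply/asboolP; split; [split => //|]; move=> p q; do 2 apply/funext => ?.
  by rewrite /contraction big1.
- move=> S T /asboolP[[S1 S2] S3] /asboolP[[T1 T2] T3]; apply/asboolP.
  split; [split; first exact: addcl|].
    by move=> s a v; rewrite !addrfctE S2 T2.
  move=> p q; rewrite -[RHS]addr0 -{1}(S3 p q) -(T3 p q).
  by do 2 apply/funext => ?; exact: big_split.
- move=> c T /asboolP[[T1 T2] T3]; apply/asboolP.
  split; [split; first exact: scl|].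
    by move=> s a v; rewrite !scalrfctE T2.
  move=> p q; rewrite -[RHS](scaler0 _ c) -(T3 p q).
  by do 2 apply/funext => ?; rewrite !scalrfctE scaler_sumr.
Qed.

Lemma tens_act_endtens (g : SL V) A : tens_act (val g) (endtens A) =
  endtens (fun i => (val g \o A i \o (val g)^-1)%VF).
Proof.
apply/funext => a; apply/funext => v; apply: eq_bigr => i _.
by rewrite !comp_lfunE.
Qed.

Lemma tens_act_tens_sl (g : SL V) T : tens_sl T -> tens_sl (tens_act (val g) T).
Proof.
move=> [m [c [A [A0 ->]]]].
exists m, c, (fun j i => (val g \o A j i \o (val g)^-1)%VF); split.
  by move=> j i; rewrite end_trace_conj A0.
transitivity (\sum_(j < m) c j *: tens_act (val g) (endtens (A j))).
  by apply/funext => a; apply/funext => v; rewrite /tens_act !fct_sumE.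
by apply: eq_bigr => j _; rewrite tens_act_endtens.
Qed.

Lemma endtens_slotl A p x alpha v :
  endtens A (fun i => if i == p then x else alpha i) v =
  x (A p (v p)) * \prod_(i | i != p) alpha i (A i (v i)).
Proof.
rewrite /endtens (bigD1 p) //= eqxx; congr (_ * _).
by apply: eq_bigr => i /negPf ->.
Qed.

Lemma endtens_slotr A p x alpha v :
  endtens A alpha (fun i => if i == p then x else v i) =
  alpha p (A p x) * \prod_(i | i != p) alpha i (A i (v i)).
Proof.
rewrite /endtens (bigD1 p) //= eqxx; congr (_ * _).
by apply: eq_bigr => i /negPf ->.
Qed.

Lemma tens_sl_linear T : tens_sl T ->
  (forall p alpha v, linear (fun x : dualV V =>
     T (fun i => if i == p then x else alpha i) v)) /\
  (forall q alpha v, linear (fun x : V =>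
     T alpha (fun i => if i == q then x else v i))).
Proof.
have ac (c d X Y Z : F) : c * ((d * X + Y) * Z) = d * (c * (X * Z)) + c * (Y * Z).
  by rewrite mulrDl mulrDr -!mulrA mulrCA.
move=> [m [c [A [_ ->]]]]; split=> p alpha v d x y;
  rewrite !fct_sumE scaler_sumr -big_split; apply: eq_bigr => j _ /=.
- rewrite !scalrfctE !endtens_slotl add_lfunE scale_lfunE.
  exact: ac.
- rewrite !scalrfctE !endtens_slotr !linearP.
  exact: ac.
Qed.

(* The contraction does not depend on the basis used to define it. *)
Lemma contraction_act (g : SL V) p q T : tens_sl T ->
  contraction p q (tens_act (val g) T) = tens_act (val g) (contraction p q T).
Proof.
move=> /tens_sl_linear[lin1 lin2].
apply/funext => alpha; apply/funext => v; rewrite /contraction /tens_act.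
pose B (x : dualV V) (y : V) :=
  T (fun i => if i == p then x else (alpha i \o val g)%VF)
    (fun i => if i == q then y else ((val g)^-1)%VF (v i)).
have BL y : linear (B^~ y) by move=> d x x'; exact: lin1.
have BR x : linear (B x) by move=> d y y'; exact: lin2.
pose BLl y := GRing.isLinear.Build F (dualV V) F^o *:%R (B^~ y) (BL y).
pose BRl x := GRing.isLinear.Build F V F^o *:%R (B x) (BR x).
pose fL y : {linear dualV V -> F^o} := HB.pack (B^~ y) (BLl y).
pose fR x : {linear V -> F^o} := HB.pack (B x) (BRl x).
have BLs y I (r : seq I) (c : I -> F) (x : I -> dualV V) :
    B (\sum_(i <- r) c i *: x i) y = \sum_(i <- r) c i *: B (x i) y.
  rewrite -[LHS]/(fL y _) linear_sum; apply: eq_bigr => i _.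
  by rewrite linearZ.
have BRs x I (r : seq I) (c : I -> F) (y : I -> V) :
    B x (\sum_(i <- r) c i *: y i) = \sum_(i <- r) c i *: B x (y i).
  rewrite -[LHS]/(fR x _) linear_sum; apply: eq_bigr => i _.
  by rewrite linearZ.
pose e a := (vbasis {:V})`_a.
transitivity (\sum_(a < \dim {:V})
    B (dual_basis a \o val g)%VF (((val g)^-1)%VF (e a))).
  apply: eq_bigr => a _; rewrite /B; congr (T _ _); apply/funext => i;
  by case: ifP.
transitivity (\sum_(b < \dim {:V}) B (dual_basis b) (e b)); last first.
  by apply: eq_bigr => a _.
have dbE a : (dual_basis a \o val g)%VF =
    \sum_(b < \dim {:V}) coord (vbasis {:V}) a (val g (e b)) *: dual_basis b.
  apply/lfunP => u; rewrite comp_lfunE dual_basisE sum_lfunE.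
  rewrite {1}(coord_vbasis (memvf u)) !linear_sum; apply: eq_bigr => b _.
  by rewrite !linearZ lfunE /= dual_basisE /GRing.scale/= mulrC.
under eq_bigr => a _ do rewrite dbE BLs.
rewrite exchange_big /=; apply: eq_bigr => b _.
rewrite -BRs; congr (B _ _).
rewrite -[RHS](lker0_lfunK (SL_lker0 g)).
rewrite [in RHS](coord_vbasis (memvf (val g (e b)))) linear_sum.
by apply: eq_bigr => a _; rewrite linearZ.
Qed.

Lemma tens_act_sym0_sl (g : SL V) T : sym0_sl T -> sym0_sl (tens_act (val g) T).
Proof.
move=> [[T1 T2] T3]; split; [split|]; first exact: tens_act_tens_sl.
  by move=> s a v; exact: T2.
by move=> p q; rewrite contraction_act // T3.
Qed.

End Tensors.

(* The space S^k_0 sl(V), as a type with its vector space structure. *)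
Section S0.
Variables (F : fieldType) (V : vectType F) (k : nat).

Definition in_S0 : {pred tensor V k} := [pred T | `[< sym0_sl T >]].

HB.instance Definition _ := GRing.isSubSemiModClosed.Build F (tensor V k) in_S0
  (@sym0_sl_subsemimod F V k).

Definition S0 := {T : tensor V k | T \in in_S0}.

HB.instance Definition _ := [isSub of S0 for sval].
HB.instance Definition _ := [Choice of S0 by <:].
HB.instance Definition _ := [SubChoice_isSubLmodule of S0 by <:].

Lemma S0_act_subproof (g : SL V) (u : S0) : tens_act (val g) (val u) \in in_S0.
Proof. by apply/asboolP/tens_act_sym0_sl/asboolP; exact: valP u. Qed.

Definition S0_act (g : SL V) (u : S0) : S0 :=
  exist _ (tens_act (val g) (val u)) (S0_act_subproof g u).

Definition End_SL_S0 : set (S0 -> S0) :=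
  [set f | linear f /\ forall g u, f (S0_act g u) = S0_act g (f u)].

End S0.

Arguments End_SL_S0 {F} V k _.

(* The group algebra F[S_k] is the library's matrix model group_ring (the     *)
(* span of the regular representation); its centre is an F-subspace of        *)
(* matrices with product *m and unit 1%:M.                                    *)
Definition center_group_ring (F : fieldType) (k : nat) :
    set 'M[F]_(gcard [set: 'S_k]%G) :=
  [set x | (x \in 'Z(group_ring F [set: 'S_k]%G))%MS].
Arguments center_group_ring : clear implicits.

(* End_{SL(V)} S^k_0 sl(V) is an algebra under composition. Only the values   *)
(* of phi on the centre matter.                                               *)
Definition is_algebra_iso (F : fieldType) (V : vectType F) (k : nat)
    (phi : 'M[F]_(gcard [set: 'S_k]%G) -> (S0 V k -> S0 V k)) : Prop :=
  let Z := center_group_ring F k in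
  [/\ set_bij Z (End_SL_S0 V k) phi,
      forall c, {in Z &, forall x y, phi (c *: x + y) = c *: phi x + phi y},
      {in Z &, forall x y, phi (x *m y) = phi x \o phi y}
    & phi 1%:M = id].

(* Main.v *)
Require Import Defs.
From HB Require Import structures.
From mathcomp Require Import all_boot all_order all_algebra all_fingroup.
From mathcomp Require Import mxrepresentation complex.
From mathcomp Require Import boolp classical_sets functions reals.
From mathcomp Require Import ring.

Set Implicit Arguments.
Unset Strict Implicit.
Unset Printing Implicit Defensive.

Import Order.TTheory GRing.Theory Num.Theory passmx.
Local Open Scope ring_scope.

(** Write [n] for the dimension of [V] and [T(A,B)] for the coordinates of a
    tensor [T] in the basis [e_A (x) e_B^*], where [A] and [B] are [k]-tuples of
    indices.  The group algebra acts on tensors by permuting the [V]-slots; the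
    action of a central element preserves symmetric trace-free tensors and
    commutes with [SL(V)].  This gives the isomorphism, and the work lies in its
    being bijective.

    Injectivity: if [2k <= n], the symmetrisation of
    [(e_1 (x) e_(k+1)^* ) (x) ... (x) (e_k (x) e_(2k)^* )] is trace-free, because
    its vectors and covectors involve disjoint sets of indices, and its
    translates by permutations of the [V]-slots are linearly independent
    ([permute_coords_injective]).

    Surjectivity: the bilinear form [sum_(A,B) U(A,B) T(B,A)] is invariant.  Its
    restriction to the symmetric trace-free tensors is nondegenerate, because the
    conjugate transpose of such a tensor is again one.  So there is an equivariant
    projection of the whole tensor space onto them ([equivariant_projection]),
    and an equivariant endomorphism [f] extends to an equivariant endomorphism
    of the whole tensor space.  Moving the covector slots to the other side
    turns its kernel into an operator on the [2k]-th tensor power of [V] which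
    commutes with [GL(V)], hence, by polynomial continuation, with all [n x n]
    matrices.  As [2k <= n], applying well-chosen matrices shows directly
    that such an operator is a combination of permutations of the [2k] slots
    ([first_fundamental_theorem]).  On a trace-free tensor, the permutations that
    mix the two blocks of [k] slots act by contractions, that is by zero
    ([slot_permutation_action]); by symmetry the others act by permutations of
    the [V]-slots alone.  Averaging their coefficients over conjugation yields a
    class function, that is a central element ([commutant_class_function]).

    The continuation argument needs equivariance under all of [GL(V)].  It follows
    from equivariance under [SL(V)], as scalars act trivially and every
    determinant has an [n]-th root ([act_coords_SL]). *)

(** * Contractions by averaging over one index *)

Section Update.
Variables (k n : nat).
Local Notation idx := {ffun 'I_k -> 'I_n}.

Implicit Types (A : idx) (p i : 'I_k) (a b : 'I_n).

Definition upd (A : idx) (p : 'I_k) (a : 'I_n) : idx :=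
  [ffun i => if i == p then a else A i].

Lemma upd_same A p a : upd A p a p = a.
Proof. by rewrite ffunE eqxx. Qed.

Lemma upd_other A p a i : i != p -> upd A p a i = A i.
Proof. by rewrite ffunE => /negPf ->. Qed.

Lemma upd_id A p a : A p = a -> upd A p a = A.
Proof. by move=> <-; apply/ffunP => i; rewrite ffunE; case: eqP => [->|]. Qed.

Lemma upd_upd A p a b : upd (upd A p a) p b = upd A p b.
Proof. by apply/ffunP => i; rewrite !ffunE; case: eqP. Qed.

(** Both sides sum [h] over the pairs of a tuple and a replacement value, up to
    exchanging that value with the one it replaces. *)
Lemma sum_upd (F : nmodType) p (h : idx -> F) :
  \sum_A \sum_a h (upd A p a) = (\sum_A h A) *+ n.
Proof.
have swapK : involutive (fun x : idx * 'I_n => (upd x.1 p x.2, x.1 p)).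
  by move=> [A a] /=; rewrite upd_upd upd_same upd_id.
rewrite pair_big /= (reindex_inj (inv_inj swapK)) /=.
rewrite -(pair_big xpredT xpredT (fun A a => h (upd (upd A p a) p (A p)))) /=.
rewrite -sumrMnl; apply: eq_bigr => A _.
rewrite -[n in _ *+ n]card_ord -sumr_const.
by apply: eq_bigr => a _; rewrite upd_upd upd_id.
Qed.

End Update.

Section TraceFree.
Variables (F : numDomainType) (k n : nat).
Local Notation idx := {ffun 'I_k -> 'I_n}.

Implicit Types (t : idx -> idx -> F) (A B : idx) (p q : 'I_k) (a b : 'I_n).

Definition trace_free (t : idx -> idx -> F) : Prop :=
  forall p q A B, \sum_a t (upd A p a) (upd B q a) = 0.

(** Averaging over the [p]-th index of [A] and the [q]-th of [B] turns the sum
    into contractions of [t] with coefficients [r]. *)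
Lemma trace_free_pairing t p q (r : idx -> idx -> F) :
    trace_free t ->
    (forall A B a b, r (upd A p a) (upd B q b) = r A B) ->
  \sum_(A : idx) \sum_(B : idx) (A p == B q)%:R * r A B * t A B = 0.
Proof.
move=> t0 r_upd; pose G A B := (A p == B q)%:R * r A B * t A B.
rewrite -/(\sum_A \sum_B G A B).
have: \sum_(A : idx) \sum_a \sum_(B : idx) \sum_b G (upd A p a) (upd B q b) = 0.
  apply: big1 => A _; rewrite exchange_big; apply: big1 => B _ /=.
  transitivity (r A B * \sum_a t (upd A p a) (upd B q a)); last first.
    by rewrite t0 mulr0.
  rewrite mulr_sumr; apply: eq_bigr => a _.
  rewrite (bigD1 a) //= big1 => [|b /negPf ba].
    by rewrite addr0 /G !upd_same eqxx mul1r r_upd.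
  by rewrite /G !upd_same eq_sym ba !mul0r.
under eq_bigr => A _ do under eq_bigr => a _ do rewrite sum_upd.
rewrite (sum_upd p (fun A => (\sum_B G A B) *+ n)) sumrMnl.
case: (posnP n) => [n0 _|n_gt0 /eqP]; last first.
  by rewrite -!mulrnA mulrn_eq0 muln_eq0 !eqn0Ngt n_gt0 => /eqP.
by apply: big1 => A _; case: (A p) => i i_lt; move: (i_lt); rewrite {1}n0.
Qed.

End TraceFree.

(** * Operators on tensor powers commuting with the general linear group *)

Section Monomials.
Variables (F : comNzRingType) (Y : finType) (n : nat).
Local Notation idx := {ffun Y -> 'I_n}.

Implicit Types (I J K : idx) (g h : 'M[F]_n).

(** The matrix entries of a tensor power of [g]. *)
Definition mono (g : 'M[F]_n) (I J : idx) : F := \prod_y g (I y) (J y).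

Lemma mono1 I J : mono 1%:M I J = (I == J)%:R.
Proof.
case: eqP => [->|neqIJ].
  by rewrite /mono big1 // => y _; rewrite mxE eqxx.
have [y neqy] : exists y, I y != J y.
  apply/existsP; apply: contra_notT neqIJ.
  by rewrite negb_exists => /forallP IJ; apply/ffunP => y; apply/eqP/negPn.
by rewrite /mono (bigD1 y) //= mxE (negPf neqy) mul0r.
Qed.

Lemma mono_mul g h I K : \sum_J mono g I J * mono h J K = mono (g *m h) I K.
Proof.
rewrite /mono; under [RHS]eq_bigr => y _ do rewrite mxE.
by rewrite bigA_distr_bigA; apply: eq_bigr => J _; rewrite -big_split.
Qed.

Lemma mono_scale c g I J : mono (c *: g) I J = c ^+ #|Y| * mono g I J.
Proof.
rewrite /mono; under eq_bigr => y _ do rewrite mxE.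
by rewrite big_split prodr_const.
Qed.

End Monomials.

Section InvariantKernels.
Variables (F : numFieldType) (Y : finType) (n : nat).
Local Notation idx := {ffun Y -> 'I_n}.
Variable Phi : idx -> idx -> F.
Implicit Types (I J K : idx) (s : {perm Y}).

(** [Phi] is the matrix of an operator on the tensor power of the standard
    representation whose slots are indexed by [Y]. *)
Definition commutes_with (g : 'M[F]_n) :=
  forall I K, \sum_J Phi I J * mono g J K = \sum_J mono g I J * Phi J K.

Hypothesis PhiGL : forall g, g \in unitmx -> commutes_with g.

(** The commutation relation at [g + t] is polynomial in [t] and holds unless
    [- t] is an eigenvalue of [g]; so it holds at [t = 0]. *)
Lemma commutes_with_all g : commutes_with g.
Proof.
move=> I K; pose G : 'M[{poly F}]_n := map_mx polyC g + 'X%:M.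
have Gt t : map_mx (horner_eval t) G = g + t%:M.
  apply/matrixP => i j; rewrite !mxE /horner_eval hornerD hornerC.
  by rewrite hornerMn hornerX.
have monoGt t I' J : (mono G I' J).[t] = mono (g + t%:M) I' J.
  rewrite /mono horner_prod; apply: eq_bigr => y _.
  by rewrite -Gt [RHS]mxE.
pose q := \sum_J (Phi I J)%:P * mono G J K - \sum_J mono G I J * (Phi J K)%:P.
have qt t : q.[t] = \sum_J Phi I J * mono (g + t%:M) J K
                  - \sum_J mono (g + t%:M) I J * Phi J K.
  rewrite hornerD hornerN !horner_sum; congr (_ - _);
  by apply: eq_bigr => J _; rewrite hornerM hornerC monoGt.
have detGt t : (\det G).[t] = \det (g + t%:M).
  by rewrite -Gt det_map_mx.
have detG_neq0 : \det G != 0.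
  have -> : G = char_poly_mx (- g).
    by rewrite /char_poly_mx map_mxN opprK addrC.
  exact/monic_neq0/char_poly_monic.
have /eqP : q * \det G = 0.
  apply: (@roots_geq_poly_eq0 _ _ [seq i%:R | i <- iota 0 (size (q * \det G))]).
  - apply/allP => t _; rewrite rootE hornerM detGt mulf_eq0 orbC.
    case: eqVneq => //= gt_unit; rewrite qt subr_eq0; apply/eqP.
    by apply: PhiGL; rewrite unitmxE unitfE.
  - by rewrite map_inj_uniq ?iota_uniq // => i j /eqP; rewrite eqr_nat => /eqP.
  - by rewrite size_map size_iota.
rewrite mulf_eq0 (negPf detG_neq0) orbF => /eqP q0.
apply/eqP; rewrite -subr_eq0.
by have := qt 0; rewrite q0 horner0 raddf0 addr0 => <-.
Qed.

Definition relabel (I : idx) (s : {perm Y}) : idx := [ffun y => I (s y)].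

(** When the slots embed in the set of basis vectors, the operator is determined
    by its value on one basis tensor [e_iota] without repetitions: every other
    [e_L] is the image of [e_iota] under a possibly singular matrix.  The image of
    [e_iota] involves only its rearrangements, as is seen by letting the
    matrices act that kill one basis vector and fix the others. *)
Lemma first_fundamental_theorem (iota : idx) : injective iota ->
  forall I L,
    Phi I L = \sum_(s : {perm Y}) (I == relabel L s)%:R * Phi (relabel iota s) iota.
Proof.
move=> iota_inj.
have Phi0 y0 J : (forall y, J y != iota y0) -> Phi J iota = 0.
  move=> Jy0; pose g : 'M[F]_n := \matrix_(a, b) ((a == b) && (a != iota y0))%:R.
  have := commutes_with_all g J iota.
  rewrite big1 => [|J' _]; last first.
    by rewrite /mono (bigD1 y0) //= mxE andbN mul0r mulr0.
  rewrite (bigD1 J) //= big1 ?addr0 => [|J' neqJ].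
    by rewrite /mono big1 ?mul1r // => y _; rewrite mxE eqxx Jy0.
  have <- : mono 1%:M J J' = mono g J J'.
    by apply: eq_bigr => y _; rewrite !mxE Jy0 andbT.
  by rewrite mono1 eq_sym (negPf neqJ) mul0r.
move=> I L.
(* the matrix that sends e_(iota y) to e_(L y) and the other e_b to 0 *)
pose g : 'M[F]_n := \matrix_(a, b) [exists y, (a == L y) && (b == iota y)]%:R.
have gE a y : g a (iota y) = (a == L y)%:R.
  rewrite mxE; congr (nat_of_bool _)%:R; apply/existsP/idP => [[y']|aLy].
    by case/andP => aL /eqP /iota_inj ->.
  by exists y; rewrite aLy eqxx.
have monog J s : mono g J (relabel iota s) = (J == relabel L s)%:R.
  by rewrite -mono1; apply: eq_bigr => y _; rewrite ffunE gE mxE ffunE.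
have relabel1 J : relabel J 1 = J by apply/ffunP => y; rewrite ffunE perm1.
transitivity (\sum_J Phi I J * mono g J iota).
  rewrite (bigD1 L) //= big1 ?addr0 => [|J neqJ]; rewrite -[iota]relabel1 monog relabel1.
    by rewrite eqxx mulr1.
  by rewrite (negPf neqJ) mulr0.
rewrite commutes_with_all.
pose im := [set relabel iota s | s in [set: {perm Y}]]%SET.
rewrite (bigID (mem im)) /= addrC big1 ?add0r => [|J].
  rewrite big_imset /= => [|s1 s2 _ _ /ffunP e12]; last first.
    by apply/permP => y; apply: iota_inj; have := e12 y; rewrite !ffunE.
  by apply: eq_big => [s|s _]; rewrite ?inE ?monog.
move=> J_im; suff [y0 Jy0] : exists y0, forall y, J y != iota y0.
  by rewrite (Phi0 y0) ?mulr0.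
apply: contraNP J_im => noy0.
have hit y : exists y', J y' == iota y.
  apply/existsP; apply: contra_notT noy0; rewrite negb_exists => /forallP Jy.
  by exists y.
pose r y := xchoose (hit y).
have Jr y : J (r y) = iota y by exact/eqP/(xchooseP (hit y)).
have r_inj : injective r by move=> y1 y2 e; apply: iota_inj; rewrite -!Jr e.
apply/imsetP; exists (perm r_inj)^-1%g => //.
apply/ffunP => y; rewrite ffunE -Jr; congr (J _).
by have := permKV (perm r_inj) y; rewrite permE.
Qed.

End InvariantKernels.

(** * Projection along the orthogonal of a subspace *)

Section OrthogonalProjection.
Variables (F : fieldType) (W : vectType F) (P : W -> Prop) (b : W -> W -> F^o).
Hypotheses (P0 : P 0) (PD : forall c u v, P u -> P v -> P (c *: u + v)).
Hypotheses (b_linearl : forall v, linear (b^~ v)) (b_linearr : forall u, linear (b u)).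
Hypothesis b_nondegenerate :
  forall u, P u -> (forall v, P v -> b v u = 0) -> u = 0.

Let form_suml I (r : seq I) c (u : I -> W) v :
  b (\sum_(i <- r) c i *: u i) v = \sum_(i <- r) c i * b (u i) v.
Proof.
pose L := GRing.isLinear.Build F W F^o *:%R _ (b_linearl v).
pose f : {linear W -> F^o} := HB.pack (b^~ v) L.
by rewrite -[LHS]/(f _) linear_sum; apply: eq_bigr => i _; rewrite linearZ.
Qed.

Let form_sumr I (r : seq I) c (u : I -> W) v :
  b v (\sum_(i <- r) c i *: u i) = \sum_(i <- r) c i * b v (u i).
Proof.
pose L := GRing.isLinear.Build F W F^o *:%R _ (b_linearr v).
pose f : {linear W -> F^o} := HB.pack (b v) L.
by rewrite -[LHS]/(f _) linear_sum; apply: eq_bigr => i _; rewrite linearZ.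
Qed.

Lemma closed_sum I (r : seq I) c (u : I -> W) :
  (forall i, P (u i)) -> P (\sum_(i <- r) c i *: u i).
Proof.
by move=> Pu; elim/big_rec: _ => // i v _ Pv; apply: PD.
Qed.

(** A free family of maximal size inside [P] generates it. *)
Lemma closed_basis :
  exists d (e : d.-tuple W),
    [/\ free e, forall i, P e`_i & forall u, P u -> u \in <<e>>%VS].
Proof.
pose has_free d := `[< exists e : d.-tuple W, free e /\ forall i, P e`_i >].
have has_free0 : exists d, has_free d.
  exists 0%N; apply/asboolP; exists [tuple]; rewrite nil_free; split=> // i.
  by rewrite nth_nil.
have bounded d : has_free d -> (d <= \dim {:W})%N.
  move=> /asboolP [e [/eqP e_free _]].
  by rewrite -(size_tuple e) -e_free dimvS ?subvf.
have [d /asboolP [e [e_free Pe]] d_max] := ex_maxnP has_free0 bounded.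
exists d, e; split=> // u Pu; apply: contraT => u_notin.
suff /d_max : has_free d.+1 by rewrite ltnn.
apply/asboolP; exists (cons_tuple u e); split; last by case.
by rewrite /= free_cons u_notin.
Qed.

(** The coefficients of the projection on a basis of [P] solve a linear system
    whose matrix is the Gram matrix of that basis, invertible by nondegeneracy. *)
Lemma orthogonal_projection_exists w :
  exists p, P p /\ forall q, P q -> b q (w - p) = 0.
Proof.
have [d [e [e_free Pe e_span]]] := closed_basis.
pose G : 'M[F]_d := \matrix_(i, j) b e`_j e`_i.
have G_unit : G \in unitmx.
  rewrite -row_free_unit -kermx_eq0; apply/rowV0P => c /sub_kermxP cG.
  pose u := \sum_(i < d) c 0 i *: e`_i.
  have u0 : u = 0.
    apply: b_nondegenerate => [|v Pv]; first exact: closed_sum.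
    rewrite (coord_span (e_span v Pv)) form_suml big1 // => j _.
    rewrite form_sumr; have /rowP/(_ j) := cG; rewrite !mxE => cGj.
    rewrite (eq_bigr (fun i => c 0 i * G i j)) ?cGj ?mulr0 // => i _.
    by rewrite mxE.
  apply/rowP => i; have := coord_sum_free (fun i => c 0 i) i e_free.
  by rewrite -/u u0 linear0 mxE => <-.
pose y := (\row_j b e`_j w) *m invmx G.
exists (\sum_(i < d) y 0 i *: e`_i); split=> [|q Pq]; first exact: closed_sum.
rewrite (coord_span (e_span q Pq)) form_suml big1 // => j _.
have b_subr u v v' : b u (v - v') = b u v - b u v'.
  by rewrite -scaleN1r addrC b_linearr addrC [-1 *: _]scaleN1r.
rewrite b_subr form_sumr.
have -> : \sum_(i < d) y 0 i * b e`_j e`_i = (y *m G) 0 j.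
  by rewrite [RHS]mxE; apply: eq_bigr => i _; congr (_ * _); rewrite mxE.
by rewrite /y mulmxKV // mxE subrr mulr0.
Qed.

End OrthogonalProjection.

(** * Symmetric trace-free tensors in coordinates *)

Section Coordinates.
Variables (F : numFieldType) (k n : nat).
Local Notation idx := {ffun 'I_k -> 'I_n}.
Local Notation coords := {ffun idx * idx -> F^o}.
Implicit Types (A B C D : idx) (t u w : coords) (g h : 'M[F]_n) (s r : 'S_k).

Let mulr_lin (a c x y : F) : a * (c * x + y) = c * (a * x) + a * y.
Proof. by rewrite mulrDr mulrCA. Qed.

Lemma relabel1 A : relabel A 1 = A.
Proof. by apply/ffunP => i; rewrite ffunE perm1. Qed.

Lemma relabelM A s r : relabel (relabel A s) r = relabel A (r * s)%g.
Proof. by apply/ffunP => i; rewrite !ffunE permM. Qed.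

Lemma relabelK s : cancel (fun A => relabel A s) (fun A => relabel A s^-1%g).
Proof. by move=> A; rewrite relabelM mulVg relabel1. Qed.

Lemma mono_relabel g A B s : mono g (relabel A s) (relabel B s) = mono g A B.
Proof.
rewrite /mono [RHS](reindex_inj (@perm_inj _ s)) /=.
by apply: eq_bigr => i _; rewrite !ffunE.
Qed.

Definition in_S0_coords t : Prop :=
  (forall s A B, t (relabel A s, relabel B s) = t (A, B)) /\
  trace_free (fun A B => t (A, B)).

Lemma in_S0_coords0 : in_S0_coords 0.
Proof.
by split=> [s A B|p q A B]; [rewrite !ffunE | rewrite big1 // => a _; rewrite ffunE].
Qed.

Lemma in_S0_coordsP c t u :
  in_S0_coords t -> in_S0_coords u -> in_S0_coords (c *: t + u).
Proof.
move=> [t_sym t0] [u_sym u0]; split=> [s A B|p q A B].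
  by rewrite !ffunE t_sym u_sym.
transitivity (c * \sum_a t (upd A p a, upd B q a) + \sum_a u (upd A p a, upd B q a)).
  by rewrite mulr_sumr -big_split; apply: eq_bigr => a _; rewrite !ffunE.
by rewrite t0 u0 mulr0 addr0.
Qed.

(** The action on coordinates of the linear map with matrix [g], whose inverse
    has matrix [h]. *)
Definition act_coords g h t : coords :=
  [ffun x => \sum_A \sum_B mono g x.1 A * mono h B x.2 * t (A, B)].

Lemma act_coordsE g h t A B :
  act_coords g h t (A, B) = \sum_C \sum_D mono g A C * mono h D B * t (C, D).
Proof. by rewrite ffunE. Qed.

Lemma act_coords_linear g h : linear (act_coords g h).
Proof.
move=> c t u; apply/ffunP => -[A B]; rewrite !ffunE /= scaler_sumr -big_split.
apply: eq_bigr => C _; rewrite scaler_sumr -big_split; apply: eq_bigr => D _ /=.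
by rewrite !ffunE; exact: mulr_lin.
Qed.

(** Contracting the result yields, because [h *m g = 1], a combination of
    contractions of [t]. *)
Lemma act_coords_in g h t :
  h *m g = 1%:M -> in_S0_coords t -> in_S0_coords (act_coords g h t).
Proof.
move=> hg [t_sym t0]; split=> [s A B|p q A B].
  rewrite !act_coordsE (reindex_inj (can_inj (relabelK s))); apply: eq_bigr => C _.
  rewrite (reindex_inj (can_inj (relabelK s))); apply: eq_bigr => D _.
  by rewrite !mono_relabel t_sym.
pose r C D := (\prod_(i | i != p) g (A i) (C i)) * \prod_(i | i != q) h (D i) (B i).
have r_upd C D a b : r (upd C p a) (upd D q b) = r C D.
  by congr (_ * _); apply: eq_bigr => i ip; rewrite upd_other.
rewrite -[RHS](trace_free_pairing t0 r_upd).
under eq_bigr => a _ do rewrite act_coordsE.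
rewrite exchange_big; apply: eq_bigr => C _.
rewrite exchange_big; apply: eq_bigr => D _ /=.
rewrite -mulr_suml; congr (_ * _).
transitivity ((\sum_a h (D q) a * g a (C p)) * r C D).
  rewrite mulr_suml; apply: eq_bigr => a _.
  have -> : mono g (upd A p a) C = g a (C p) * \prod_(i | i != p) g (A i) (C i).
    rewrite /mono (bigD1 p) //= upd_same; congr (_ * _).
    by apply: eq_bigr => i ip; rewrite upd_other.
  have -> : mono h D (upd B q a) = h (D q) a * \prod_(i | i != q) h (D i) (B i).
    rewrite /mono (bigD1 q) //= upd_same; congr (_ * _).
    by apply: eq_bigr => i iq; rewrite upd_other.
  by rewrite mulrACA [g _ _ * _]mulrC.
by have /matrixP/(_ (D q) (C p)) := hg; rewrite !mxE eq_sym => ->.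
Qed.

(** The transposition makes this form invariant: [V]-slots are paired with
    [V^*]-slots. *)
Definition pairing u t : F^o := \sum_A \sum_B u (A, B) * t (B, A).

Lemma pairing_linearl t : linear (pairing^~ t).
Proof.
move=> c u w; rewrite /pairing scaler_sumr -big_split.
apply: eq_bigr => A _; rewrite scaler_sumr -big_split; apply: eq_bigr => B _ /=.
by rewrite !ffunE ![_ * t _]mulrC; exact: mulr_lin.
Qed.

Lemma pairing_linearr u : linear (pairing u).
Proof.
move=> c t w; rewrite /pairing scaler_sumr -big_split.
apply: eq_bigr => A _; rewrite scaler_sumr -big_split; apply: eq_bigr => B _ /=.
by rewrite !ffunE; exact: mulr_lin.
Qed.

Lemma pairing_act g h u t :
  pairing (act_coords g h u) t = pairing u (act_coords h g t).
Proof.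
pose f A B C D := mono g A C * mono h D B * u (C, D) * t (B, A).
transitivity (\sum_C \sum_A \sum_D \sum_B f A B C D).
  rewrite exchange_big; apply: eq_bigr => A _.
  transitivity (\sum_B \sum_C \sum_D f A B C D).
    apply: eq_bigr => B _; rewrite act_coordsE mulr_suml; apply: eq_bigr => C _.
    by rewrite mulr_suml.
  by rewrite exchange_big; apply: eq_bigr => C _; rewrite exchange_big.
apply: eq_bigr => C _; rewrite exchange_big; apply: eq_bigr => D _ /=.
rewrite act_coordsE exchange_big mulr_sumr; apply: eq_bigr => B _.
rewrite mulr_sumr; apply: eq_bigr => A _.
by rewrite mulrA /f [_ * u _]mulrC [mono g _ _ * _]mulrC.
Qed.

End Coordinates.

Section Projection.
Variables (C : numClosedFieldType) (k n : nat).
Local Notation idx := {ffun 'I_k -> 'I_n}.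
Local Notation coords := {ffun idx * idx -> C^o}.
Implicit Types (t u w : coords) (g h : 'M[C]_n).

(** The conjugate transpose of [t] is symmetric and trace-free, and its pairing
    with [t] is the sum of the squared moduli of the coordinates of [t]. *)
Lemma pairing_nondegenerate t :
  in_S0_coords t -> (forall u, in_S0_coords u -> pairing u t = 0) -> t = 0.
Proof.
move=> [t_sym t0] t_orth.
pose u : coords := [ffun x => (t (x.2, x.1))^*].
have u_in : in_S0_coords u.
  split=> [s A B|p q A B]; first by rewrite !ffunE /= t_sym.
  transitivity ((\sum_a t (upd B q a, upd A p a))^*); last by rewrite t0 rmorph0.
  by rewrite rmorph_sum; apply: eq_bigr => a _; rewrite ffunE.
have /eqP := t_orth u u_in; rewrite /pairing pair_big /=.
under eq_bigr => x _ do rewrite ffunE /= mulrC -normCK.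
rewrite psumr_eq0 => [/allP t_eq0|x _]; last by rewrite exprn_ge0.
apply/ffunP => -[A B]; have := t_eq0 (B, A) (mem_index_enum _).
by rewrite ffunE /= expf_eq0 normr_eq0 => /eqP.
Qed.

(** The projection is characterised by orthogonality, so its linearity and
    equivariance follow from those of the form. *)
Lemma equivariant_projection :
  exists pi : coords -> coords,
    [/\ linear pi, forall t, in_S0_coords (pi t),
        forall t, in_S0_coords t -> pi t = t
      & forall g h t, g *m h = 1%:M -> h *m g = 1%:M ->
          pi (act_coords g h t) = act_coords g h (pi t)].
Proof.
have proj := orthogonal_projection_exists (@in_S0_coords0 _ k n)
  (@in_S0_coordsP _ k n) (@pairing_linearl _ k n) (@pairing_linearr _ k n)
  pairing_nondegenerate.
pose is_proj w p := in_S0_coords p /\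
  forall q, in_S0_coords q -> pairing q (w - p) = 0.
have pairingD c q u w : pairing q (c *: u + w) = c * pairing q u + pairing q w.
  exact: pairing_linearr.
have sub_in u w : in_S0_coords u -> in_S0_coords w -> in_S0_coords (u - w).
  by move=> u_in w_in; rewrite addrC -scaleN1r; apply: in_S0_coordsP.
have proj_unique w p1 p2 : is_proj w p1 -> is_proj w p2 -> p1 = p2.
  move=> [p1_in p1w] [p2_in p2w]; apply/eqP; rewrite -subr_eq0; apply/eqP.
  apply: pairing_nondegenerate => [|q q_in]; first exact: sub_in.
  have -> : p1 - p2 = (-1) *: (w - p1) + (w - p2).
    by rewrite scaleN1r opprB addrA subrK.
  by rewrite pairingD p1w // p2w // mulr0 addr0.
have [pi piP] := choice proj.
exists pi; split=> [c u w|t|t t_in|g h t gh hg].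
- have [[u_in u_orth] [w_in w_orth]] := (piP u, piP w).
  apply: (proj_unique (c *: u + w)) => //; split; first exact: in_S0_coordsP.
  move=> q q_in; rewrite opprD addrACA -scalerBr pairingD u_orth // w_orth //.
  by rewrite mulr0 addr0.
- by have [] := piP t.
- apply: (proj_unique t) => //; split=> // q _.
  by rewrite subrr -(addNr t) -scaleN1r pairingD mulN1r addNr.
- have [t_in t_orth] := piP t.
  apply: (proj_unique (act_coords g h t)) => //; split; first exact: act_coords_in.
  move=> q q_in.
  have -> : act_coords g h t - act_coords g h (pi t) = act_coords g h (t - pi t).
    by rewrite addrC -scaleN1r -act_coords_linear scaleN1r addrC.
  by rewrite -pairing_act t_orth //; apply: act_coords_in.
Qed.

End Projection.

(** * From endomorphisms of mixed tensors to permutations of slots *)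

Section Glue.
Variables (F : numFieldType) (k n : nat).
Local Notation idx := {ffun 'I_k -> 'I_n}.
Local Notation slots := ('I_k + 'I_k)%type.
Local Notation idx2 := {ffun slots -> 'I_n}.
Implicit Types (A B C D : idx) (I J L : idx2) (g h : 'M[F]_n) (s : {perm slots}).

Definition glue A B : idx2 :=
  [ffun y => match y with inl i => A i | inr i => B i end].
Definition lpart I : idx := [ffun i => I (inl i)].
Definition rpart I : idx := [ffun i => I (inr i)].

Lemma glueK I : glue (lpart I) (rpart I) = I.
Proof. by apply/ffunP => -[] i; rewrite !ffunE. Qed.

Lemma lpart_glue A B : lpart (glue A B) = A.
Proof. by apply/ffunP => i; rewrite !ffunE. Qed.

Lemma rpart_glue A B : rpart (glue A B) = B.
Proof. by apply/ffunP => i; rewrite !ffunE. Qed.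

Lemma sum_glue (V : nmodType) (f : idx2 -> V) :
  \sum_I f I = \sum_A \sum_B f (glue A B).
Proof.
rewrite pair_big /= (reindex (fun x : idx * idx => glue x.1 x.2)) //=.
exists (fun I => (lpart I, rpart I)) => [[A B]|I] _ /=.
  by rewrite lpart_glue rpart_glue.
exact: glueK.
Qed.

Lemma mono_glue g A B C D : mono g (glue A B) (glue C D) = mono g A C * mono g B D.
Proof.
by rewrite /mono big_sumType; congr (_ * _); apply: eq_bigr => i _; rewrite !ffunE.
Qed.

Lemma mono_unit g h A B : g *m h = 1%:M -> \sum_C mono g A C * mono h C B = (A == B)%:R.
Proof. by move=> gh; rewrite mono_mul gh mono1. Qed.

Lemma sum_delta A (f : idx -> F) : \sum_B (A == B)%:R * f B = f A.
Proof.
rewrite (bigD1 A) //= eqxx mul1r big1 ?addr0 // => B /negPf neqB.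
by rewrite eq_sym neqB mul0r.
Qed.

(** Moving each factor [h], the inverse of [g], to the other side of the
    equivariance relation of [K] exchanges the roles of the covector indices
    [B] and [D], and leaves only factors [g]. *)
Lemma transposed_kernel_commutes (K : idx -> idx -> idx -> idx -> F) g h :
    g *m h = 1%:M -> h *m g = 1%:M ->
    (forall A B C' D',
      \sum_C \sum_D K A B C D * (mono g C C' * mono h D' D) =
      \sum_A' \sum_B' mono g A A' * mono h B' B * K A' B' C' D') ->
  commutes_with (fun I J => K (lpart I) (rpart J) (lpart J) (rpart I)) g.
Proof.
move=> gh hg Kg I J; rewrite -[I]glueK -[J]glueK.
move: (lpart I) (rpart I) (lpart J) (rpart J) => A E C' G.
rewrite !sum_glue.
transitivity (\sum_B mono g B G * \sum_D' mono g E D' *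
    \sum_C \sum_D K A B C D * (mono g C C' * mono h D' D)).
  rewrite exchange_big; apply: eq_bigr => B _ /=.
  transitivity (mono g B G * \sum_C K A B C E * mono g C C').
    rewrite mulr_sumr; apply: eq_bigr => C _.
    rewrite !lpart_glue !rpart_glue mono_glue; ring.
  congr (_ * _); under [RHS]eq_bigr => D' _ do rewrite mulr_sumr.
  rewrite exchange_big; apply: eq_bigr => C _ /=.
  under [RHS]eq_bigr => D' _ do rewrite mulr_sumr.
  rewrite exchange_big /= -(sum_delta E (fun D => K A B C D * mono g C C')).
  apply: eq_bigr => D _; rewrite -(mono_unit _ _ gh) mulr_suml.
  by apply: eq_bigr => D' _; ring.
under eq_bigr => B _ do under eq_bigr => D' _ do rewrite Kg.
transitivity (\sum_A' \sum_D' \sum_B' (B' == G)%:R *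
    (mono g A A' * mono g E D' * K A' B' C' D')); last first.
  apply: eq_bigr => A' _; apply: eq_bigr => D' _.
  under eq_bigr => B' _ do rewrite eq_sym.
  by rewrite sum_delta mono_glue !lpart_glue !rpart_glue.
transitivity (\sum_B \sum_A' \sum_D' \sum_B'
    mono g B G * (mono g E D' * (mono g A A' * mono h B' B * K A' B' C' D'))).
  apply: eq_bigr => B _; rewrite mulr_sumr exchange_big; apply: eq_bigr => D' _ /=.
  rewrite mulr_sumr mulr_sumr; apply: eq_bigr => A' _.
  by rewrite mulr_sumr mulr_sumr.
rewrite exchange_big; apply: eq_bigr => A' _ /=.
rewrite exchange_big; apply: eq_bigr => D' _ /=.
rewrite exchange_big; apply: eq_bigr => B' _ /=.
rewrite -(mono_unit _ _ hg) mulr_suml; apply: eq_bigr => B _; ring.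
Qed.

(** Either [s] preserves both blocks or, by counting, it links a slot of the
    second block to a slot of the first. *)
Lemma perm_blocksP s :
  (exists s1 s2 : 'S_k, (forall i, s (inl i) = inl (s1 i)) /\
                        (forall i, s (inr i) = inr (s2 i))) \/
  (exists p q, s (inr p) = inl q).
Proof.
case: (pselect (exists p q, s (inr p) = inl q)) => [|no_link]; [by right|left].
have inr_stable i : exists j, s (inr i) == inr j.
  case e: (s (inr i)) => [q|j]; last by exists j.
  by case: no_link; exists i, q.
pose f2 i := xchoose (inr_stable i).
have f2E i : s (inr i) = inr (f2 i) by exact/eqP/(xchooseP (inr_stable i)).
have f2_inj : injective f2.
  by move=> i j e; apply: (@inr_inj 'I_k 'I_k); apply: (@perm_inj _ s); rewrite !f2E e.
have inl_stable i : exists j, s (inl i) == inl j.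
  case e: (s (inl i)) => [j|j]; first by exists j.
  have : s (inr (invF f2_inj j)) = s (inl i) by rewrite f2E f_invF e.
  by move/perm_inj.
pose f1 i := xchoose (inl_stable i).
have f1E i : s (inl i) = inl (f1 i) by exact/eqP/(xchooseP (inl_stable i)).
have f1_inj : injective f1.
  by move=> i j e; apply: (@inl_inj 'I_k 'I_k); apply: (@perm_inj _ s); rewrite !f1E e.
by exists (perm f1_inj), (perm f2_inj); split=> i; rewrite permE.
Qed.

(** If [s] links two blocks, the sum over the two linked indices is a
    contraction of [u].  Otherwise the symmetry of [u] moves the permutation of
    the covector slots over to the vector slots. *)
Lemma slot_permutation_action s : exists o : option 'S_k,
  forall (u : {ffun idx * idx -> F^o}) A B, in_S0_coords u ->
  \sum_C \sum_D (glue A D == relabel (glue C B) s)%:R * u (C, D) =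
  oapp (fun r => u (relabel A r, B)) 0 o.
Proof.
case: (perm_blocksP s) => [[s1 [s2 [s1E s2E]]]|[p [q spq]]].
  exists (Some (s2^-1 * s1^-1)%g) => u A B [u_sym _] /=.
  rewrite -relabelM -[B in RHS](relabelK s2) u_sym.
  rewrite -(sum_delta (relabel A s1^-1) (fun C => u (C, relabel B s2))).
  apply: eq_bigr => C _; rewrite -(sum_delta (relabel B s2) (fun D => u (C, D))).
  rewrite mulr_sumr; apply: eq_bigr => D _; rewrite mulrA -natrM mulnb.
  congr ((nat_of_bool _)%:R * _); apply/eqP/andP => [/ffunP e|[/eqP <- /eqP <-]].
    split; apply/eqP.
      rewrite -[C](relabelK s1); congr (relabel _ _).
      by apply/ffunP => i; have := e (inl i); rewrite !ffunE s1E.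
    by apply/ffunP => i; have := e (inr i); rewrite !ffunE s2E => ->.
  by apply/ffunP => -[] i; rewrite !ffunE ?s1E ?s2E /= ?ffunE ?permK.
exists None => u A B [_ u0] /=.
pose r C D : F :=
  \prod_(y | y != inr p) (glue A D y == relabel (glue C B) s y)%:R.
rewrite -[RHS](@trace_free_pairing F k n _ q p r u0) => [|C D a b].
  apply: eq_bigr => C _; apply: eq_bigr => D _; congr (_ * _).
  rewrite -(mono1 F) /mono (bigD1 (inr p)) //= mxE !ffunE spq eq_sym.
  by congr (_ * _); apply: eq_bigr => y _; rewrite mxE.
apply: eq_bigr => y y_neq; congr (nat_of_bool (_ == _))%:R; rewrite !ffunE.
  by case: y y_neq => // i i_neq; rewrite upd_other //; apply: contraNneq i_neq => ->.
case sy: (s y) => [i|//]; rewrite upd_other //; apply: contraNneq y_neq => iq.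
by apply/eqP; apply: (@perm_inj _ s); rewrite sy iq spq.
Qed.

End Glue.

Section Commutant.
Variables (C : numClosedFieldType) (k n : nat).
Local Notation idx := {ffun 'I_k -> 'I_n}.
Local Notation coords := {ffun idx * idx -> C^o}.
Implicit Types (A B : idx) (t u w : coords) (g h : 'M[C]_n) (d : 'S_k -> C).

Definition permute_coords d t : coords :=
  [ffun x => \sum_s d s * t (relabel x.1 s, x.2)].

Variable f : coords -> coords.
Hypothesis f_linear : forall c t u, in_S0_coords t -> in_S0_coords u ->
  f (c *: t + u) = c *: f t + f u.
Hypothesis f_in : forall t, in_S0_coords t -> in_S0_coords (f t).
Hypothesis f_act : forall g h t, g *m h = 1%:M -> h *m g = 1%:M ->
  in_S0_coords t -> f (act_coords g h t) = act_coords g h (f t).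
Variable iota : {ffun ('I_k + 'I_k)%type -> 'I_n}.
Hypothesis iota_inj : injective iota.

(** The kernel of [f] composed with the equivariant projection is a combination
    of slot permutations, each of which acts on symmetric trace-free tensors by
    zero or by a permutation of the vector slots. *)
Lemma commutant_sum_permutations :
  exists d, forall t, in_S0_coords t -> f t = permute_coords d t.
Proof.
have [pi [pi_lin pi_in pi_id pi_act]] := equivariant_projection C k n.
pose G t := f (pi t).
have G_lin : linear G by move=> c t u; rewrite /G pi_lin f_linear.
pose GL := GRing.isLinear.Build C coords coords *:%R G G_lin.
pose GG : {linear coords -> coords} := HB.pack G GL.
pose delta A B : coords := [ffun x => (x == (A, B))%:R].
have delta_sum t : t = \sum_A \sum_B t (A, B) *: delta A B.
  apply/ffunP => -[A B]; rewrite pair_big /= sum_ffunE (bigD1 (A, B)) //=.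
  rewrite !ffunE eqxx big1 => [|[A' B'] /negPf neq].
    by rewrite addr0; exact: esym (mulr1 _).
  by rewrite !ffunE eq_sym neq; exact: mulr0.
pose K A B A' B' : C := G (delta A' B') (A, B).
have GE t A B : G t (A, B) = \sum_A' \sum_B' K A B A' B' * t (A', B').
  rewrite {1}[t]delta_sum -[G _]/(GG _) linear_sum sum_ffunE.
  apply: eq_bigr => A' _; rewrite linear_sum sum_ffunE; apply: eq_bigr => B' _.
  by rewrite linearZ ffunE; exact: mulrC.
have act_delta g h A' B' A B :
    act_coords g h (delta A' B') (A, B) = mono g A A' * mono h B' B.
  rewrite act_coordsE pair_big /= (bigD1 (A', B')) //= ffunE eqxx mulr1.
  by rewrite big1 ?addr0 // => x /negPf neq; rewrite ffunE -surjective_pairing neq mulr0.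
pose Phi (I J : {ffun ('I_k + 'I_k)%type -> 'I_n}) :=
  K (lpart I) (rpart J) (lpart J) (rpart I).
have Phi_comm g : g \in unitmx -> commutes_with Phi g.
  move=> g_unit; have gh := mulmxV g_unit; have hg := mulVmx g_unit.
  apply: (transposed_kernel_commutes gh hg) => A B C' D'.
  transitivity (G (act_coords g (invmx g) (delta C' D')) (A, B)).
    rewrite GE; apply: eq_bigr => A' _; apply: eq_bigr => B' _.
    by rewrite act_delta.
  by rewrite /G pi_act // f_act // act_coordsE.
have FFT := first_fundamental_theorem Phi_comm iota_inj.
have [o oE] := choice (@slot_permutation_action C k n).
pose c s := Phi (relabel iota s) iota.
exists (fun r => \sum_(s | o s == Some r) c s) => t t_in.
apply/ffunP => -[A B]; rewrite [RHS]ffunE /= -[t in LHS]pi_id // -/(G t) GE.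
transitivity (\sum_s c s * oapp (fun r => t (relabel A r, B)) 0 (o s)).
  transitivity (\sum_A' \sum_B' \sum_s
    c s * ((glue A B' == relabel (glue A' B) s)%:R * t (A', B'))).
    apply: eq_bigr => A' _; apply: eq_bigr => B' _.
    have -> : K A B A' B' = Phi (glue A B') (glue A' B).
      by rewrite /Phi !lpart_glue !rpart_glue.
    rewrite FFT mulr_suml; apply: eq_bigr => s _; rewrite -/(c s) mulrA.
    by congr (_ * _); rewrite mulrC.
  under eq_bigr => A' _ do rewrite exchange_big.
  rewrite exchange_big; apply: eq_bigr => s _ /=.
  rewrite -(oE s t A B t_in) mulr_sumr; apply: eq_bigr => A' _.
  by rewrite mulr_sumr.
under [RHS]eq_bigr => r _ do rewrite mulr_suml.
rewrite (exchange_big_dep xpredT) //=; apply: eq_bigr => s _.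
case: (o s) => [r|] /=; last by rewrite mulr0 big_pred0.
by rewrite (bigD1 r) //= big1 ?addr0 // => r' /andP [/eqP [->]]; rewrite eqxx.
Qed.

(** As [f t] is symmetric, conjugating the coefficients [d] by a permutation
    does not change the action on [t]; so they can be averaged. *)
Lemma commutant_class_function :
  exists d, (forall s r, d (s ^ r)%g = d s) /\
    forall t, in_S0_coords t -> f t = permute_coords d t.
Proof.
have [d0 d0E] := commutant_sum_permutations.
pose N : C := #|{: 'S_k}|%:R.
have N_neq0 : N != 0 by rewrite pnatr_eq0 -lt0n; apply/card_gt0P; exists 1%g.
exists (fun s => N^-1 * \sum_r d0 (s ^ r)%g); split=> [s r|t t_in].
  congr (_ * _); rewrite [RHS](reindex_inj (mulgI r)).
  by apply: eq_bigr => x _; rewrite conjgM.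
apply/ffunP => -[A B]; apply: (mulfI N_neq0); rewrite ffunE /=.
transitivity (\sum_(r : 'S_k) f t (relabel A r^-1, relabel B r^-1)).
  rewrite (eq_bigr (fun=> f t (A, B))) => [|r _]; last by have [->] := f_in t_in.
  by rewrite sumr_const /N mulr_natl.
transitivity (\sum_s \sum_r d0 (s ^ r)%g * t (relabel A s, B)); last first.
  rewrite mulr_sumr; apply: eq_bigr => s _; rewrite -mulr_suml !mulrA.
  by rewrite mulfV // mul1r.
rewrite exchange_big /=; apply: eq_bigr => r _.
rewrite d0E // ffunE /= (reindex_inj (conjg_inj r)) /=; apply: eq_bigr => s _.
have [t_sym _] := t_in; rewrite relabelM -[in RHS](t_sym r^-1%g) relabelM.
by rewrite conjgE -mulgA mulgK.
Qed.

End Commutant.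

(** * Coordinates of tensors *)

Section CoordinatesOfTensors.
Variables (C : numClosedFieldType) (V : vectType C) (k : nat).
Local Notation n := (\dim {:V}).
Local Notation e := (vbasis {:V}).
Local Notation idx := {ffun 'I_k -> 'I_n}.
Local Notation coords := {ffun idx * idx -> C^o}.
Implicit Types (T : tensor V k) (w : coords) (A B : idx).
Implicit Types (alpha : 'I_k -> dualV V) (v : 'I_k -> V).

Definition tensor_coords T : coords :=
  [ffun x : idx * idx => T (fun i => dual_basis (x.1 i)) (fun i => e`_(x.2 i))].

Definition basis_mono A B alpha v : C :=
  \prod_i (alpha i e`_(A i) * coord e (B i) (v i)).

Definition tensor_of_coords w : tensor V k :=
  fun alpha v => \sum_A \sum_B w (A, B) * basis_mono A B alpha v.

Lemma dual_basis_vbasis (a b : 'I_n) : dual_basis a e`_b = (b == a)%:R :> C.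
Proof. by rewrite dual_basisE coord_free // (basis_free (vbasis_fullvP V)). Qed.

Lemma tensor_of_coordsK : cancel tensor_of_coords tensor_coords.
Proof.
move=> w; apply/ffunP => -[A B]; rewrite ffunE /tensor_of_coords /=.
have bmE A' B' : basis_mono A' B' (fun i => dual_basis (A i)) (fun i => e`_(B i)) =
    (A == A')%:R * (B == B')%:R.
  rewrite -!mono1 -big_split /=; apply: eq_bigr => i _.
  by rewrite dual_basis_vbasis -dual_basisE dual_basis_vbasis !mxE eq_sym.
rewrite -(sum_delta A (fun A' => w (A', B))); apply: eq_bigr => A' _.
rewrite -(sum_delta B (fun B' => w (A', B'))) mulr_sumr; apply: eq_bigr => B' _.
by rewrite bmE mulrA mulrC.
Qed.

Lemma tensor_coords_linear : linear tensor_coords.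
Proof. by move=> c T U; apply/ffunP => x; rewrite !ffunE. Qed.

Lemma tensor_of_coords_linear : linear tensor_of_coords.
Proof.
move=> c w u; apply/funext => alpha; apply/funext => v.
transitivity (c * tensor_of_coords w alpha v + tensor_of_coords u alpha v) => //.
rewrite /tensor_of_coords mulr_sumr -big_split; apply: eq_bigr => A _ /=.
rewrite mulr_sumr -big_split; apply: eq_bigr => B _ /=.
by rewrite !ffunE mulrA -mulrDl.
Qed.

Lemma endtens_coords (E : 'I_k -> 'End(V)) :
  endtens E = tensor_of_coords (tensor_coords (endtens E)).
Proof.
apply/funext => alpha; apply/funext => v; rewrite /tensor_of_coords.
have rotate_mul (x y z : C) : x * (y * z) = y * (z * x) by ring.
transitivity (\prod_i \sum_(a < n) \sum_(b < n)
    (dual_basis a (E i e`_b) * (alpha i e`_a * coord e b (v i))) : C).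
  apply: eq_bigr => i _; rewrite exchange_big.
  rewrite [v i in LHS](coord_vbasis (memvf _)) !linear_sum; apply: eq_bigr => b _.
  rewrite !linearZ /= [E i e`_b in LHS](coord_vbasis (memvf _)) linear_sum.
  rewrite scaler_sumr; apply: eq_bigr => a _.
  rewrite linearZ dual_basisE; exact: rotate_mul.
rewrite bigA_distr_bigA; apply: eq_bigr => A _.
rewrite bigA_distr_bigA; apply: eq_bigr => B _.
by rewrite ffunE -big_split.
Qed.

Lemma tensor_coordsK T : tens_sl T -> tensor_of_coords (tensor_coords T) = T.
Proof.
pose L1 := GRing.isLinear.Build C _ _ *:%R _ tensor_coords_linear.
pose L2 := GRing.isLinear.Build C _ _ *:%R _ tensor_of_coords_linear.
pose f1 : {linear tensor V k -> coords} := HB.pack tensor_coords L1.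
pose f2 : {linear coords -> tensor V k} := HB.pack tensor_of_coords L2.
move=> [m [c [E [_ ->]]]]; rewrite -[LHS]/(f2 (f1 _)) !linear_sum.
by apply: eq_bigr => j _; rewrite !linearZ /= -endtens_coords.
Qed.

Lemma sym0_sl_coords T : sym0_sl T -> in_S0_coords (tensor_coords T).
Proof.
move=> [[_ T_sym] T0]; split=> [s A B|p q A B].
  rewrite !ffunE -[RHS](T_sym s) /=.
  by congr (T _ _); apply/funext => i /=; rewrite ffunE.
transitivity (contraction p q T (fun i => dual_basis (A i)) (fun i => e`_(B i))).
  apply: eq_bigr => a _; rewrite ffunE /=.
  by congr (T _ _); apply/funext => i; rewrite ffunE; case: ifP.
by rewrite T0.
Qed.


(** The trace-free part of the endomorphism [e_a (x) e_b^*].  The matrix is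
    transposed because matrices act on row vectors here. *)
Definition traceless (a b : 'I_n) : 'End(V) :=
  hommx e e (delta_mx b a - ((a == b)%:R / n%:R)%:M).

Lemma tracelessE (a b : 'I_n) x :
  traceless a b x = coord e b x *: e`_a - ((a == b)%:R / n%:R) *: x.
Proof.
have e_basis := vbasis_fullvP V.
rewrite hommxE // mulmxBr linearB /=; congr (_ - _).
  rewrite -vecof_delta -linearZ; congr (vecof _ _); apply/rowP => j.
  rewrite !mxE (bigD1 b) //= !mxE eqxx big1 ?addr0 //= => i /negPf i_neq.
  by rewrite !mxE i_neq mulr0.
by rewrite mul_mx_scalar linearZ /= rVofK.
Qed.

Lemma traceless_trace (a b : 'I_n) : end_trace (traceless a b) = 0.
Proof.
have e_basis := vbasis_fullvP V.
have n_gt0 : (0 < n)%N by case: n a => [[]|].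
rewrite /end_trace /end_mx hommxK // linearB /= mxtrace_scalar.
rewrite -[_ / _ *+ _]mulr_natr divfK ?pnatr_eq0 -?lt0n //.
rewrite /mxtrace (bigD1 a) //= mxE eqxx andbT big1 ?addr0 ?subrr // => i /negPf neq.
by rewrite mxE neq andbF.
Qed.

Lemma tens_sl_sum (I : Type) (r : seq I) (f : I -> tensor V k) :
  (forall i, tens_sl (f i)) -> tens_sl (\sum_(i <- r) f i).
Proof.
have [_ [sl0 slD]] := tens_sl_subsemimod V k.
by move=> f_sl; elim/big_rec: _ => // i T _; apply: slD.
Qed.

(** Projecting every slot of a tensor to [sl(V)] changes it only by terms that
    contain one of its diagonal contractions. *)
Lemma tensor_of_coords_traceless w : in_S0_coords w ->
  tensor_of_coords w =
  \sum_A \sum_B w (A, B) *: endtens (fun i => traceless (A i) (B i)).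
Proof.
move=> [_ w0]; apply/funext => alpha; apply/funext => v.
pose x i (a b : 'I_n) : C := alpha i e`_a * coord e b (v i).
pose y i (a b : 'I_n) : C := - ((a == b)%:R / n%:R * alpha i (v i)).
(* s records the slots at which the main term of traceless is chosen *)
pose X (s : {ffun 'I_k -> bool}) i a b := if s i then x i a b else y i a b.
transitivity (\sum_(s : {ffun 'I_k -> bool}) \sum_A \sum_B
    w (A, B) * \prod_i X s i (A i) (B i)); last first.
  rewrite exchange_big fct_sumE fct_sumE; apply: eq_bigr => A _ /=.
  rewrite exchange_big fct_sumE fct_sumE; apply: eq_bigr => B _ /=.
  rewrite -mulr_sumr; congr (_ * _).
  transitivity (\prod_i \sum_(c : bool) if c then x i (A i) (B i) else y i (A i) (B i)).
    by rewrite bigA_distr_bigA.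
  apply: eq_bigr => i _; rewrite big_bool /= tracelessE linearB !linearZ /=.
  by congr (_ + _); [exact: mulrC | rewrite /y -mulrN].
rewrite (bigD1 ([ffun => true] : {ffun _ -> bool})) //= [X in _ + X]big1 => [|s s_neq].
  rewrite addr0; apply: eq_bigr => A _; apply: eq_bigr => B _; congr (_ * _).
  by apply: eq_bigr => i _; rewrite /X ffunE.
have [p sp] : exists p, ~~ s p.
  apply/existsP; apply: contraNT s_neq; rewrite negb_exists => /forallP s_true.
  by apply/eqP/ffunP => i; rewrite ffunE; have := s_true i; rewrite negbK.
pose r A B := - (n%:R^-1 * alpha p (v p)) * \prod_(i | i != p) X s i (A i) (B i).
have r_upd A B a b : r (upd A p a) (upd B p b) = r A B.
  by congr (_ * _); apply: eq_bigr => i ip; rewrite !upd_other.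
rewrite -[RHS](trace_free_pairing w0 r_upd).
apply: eq_bigr => A _; apply: eq_bigr => B _; rewrite mulrC; congr (_ * _).
rewrite (bigD1 p) //= {1}/X (negPf sp) /y /r mulrA; congr (_ * _).
by rewrite mulrN mulrA.
Qed.

Lemma sym0_sl_of_coords w : in_S0_coords w -> sym0_sl (tensor_of_coords w).
Proof.
move=> w_in; have [w_sym w0] := w_in; split; [split|].
- rewrite tensor_of_coords_traceless //.
  apply: tens_sl_sum => A; apply: tens_sl_sum => B.
  exists 1%N, (fun=> w (A, B)), (fun _ i => traceless (A i) (B i)); split.
    by move=> _ i; exact: traceless_trace.
  by rewrite big_ord1.
- move=> s alpha v; rewrite /tensor_of_coords.
  rewrite (reindex_inj (can_inj (relabelK s))); apply: eq_bigr => A _.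
  rewrite (reindex_inj (can_inj (relabelK s))); apply: eq_bigr => B _.
  rewrite w_sym; congr (_ * _); rewrite /basis_mono.
  rewrite [RHS](reindex_inj (@perm_inj _ s)) /=.
  by apply: eq_bigr => i _; rewrite !ffunE.
- move=> p q; apply/funext => alpha; apply/funext => v.
  pose r A B : C := \prod_(i | i != p) alpha i e`_(A i) *
                    \prod_(i | i != q) coord e (B i) (v i).
  have r_upd A B a b : r (upd A p a) (upd B q b) = r A B.
    by congr (_ * _); apply: eq_bigr => i ip; rewrite !upd_other.
  rewrite -[RHS](trace_free_pairing w0 r_upd) /contraction /tensor_of_coords.
  rewrite exchange_big; apply: eq_bigr => A _.
  rewrite exchange_big; apply: eq_bigr => B _ /=.
  rewrite -mulr_sumr mulrC; congr (_ * _).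
  transitivity (\sum_(a < n) (A p == a)%:R * ((a == B q)%:R * r A B)).
    apply: eq_bigr => a _; rewrite /basis_mono big_split /=.
    have -> : \prod_i (if i == p then dual_basis a else alpha i) e`_(A i) =
        (A p == a)%:R * \prod_(i | i != p) alpha i e`_(A i) :> C.
      rewrite (bigD1 p) //= eqxx dual_basis_vbasis; congr (_ * _).
      by apply: eq_bigr => i /negPf ->.
    have -> : \prod_i coord e (B i) (if i == q then e`_a else v i) =
        (a == B q)%:R * \prod_(i | i != q) coord e (B i) (v i).
      rewrite (bigD1 q) //= eqxx -dual_basisE dual_basis_vbasis; congr (_ * _).
      by apply: eq_bigr => i /negPf ->.
    by rewrite mulrACA [RHS]mulrA.
  rewrite (bigD1 (A p)) //= eqxx mul1r big1 ?addr0 // => a /negPf neq.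
  by rewrite eq_sym neq mul0r.
Qed.

End CoordinatesOfTensors.

(** * The action of the special linear group in coordinates *)

Section SLAction.
Variables (C : numClosedFieldType) (V : vectType C) (k : nat).
Local Notation n := (\dim {:V}).
Local Notation e := (vbasis {:V}).
Local Notation idx := {ffun 'I_k -> 'I_n}.
Local Notation coords := {ffun idx * idx -> C^o}.
Implicit Types (T : tensor V k) (w : coords) (A B : idx) (u : S0 V k).

(** The transpose converts from row-vector to column-vector conventions. *)
Definition coord_mx (g : 'End(V)) : 'M[C]_n := (end_mx g)^T.

Lemma coord_mxE g (a b : 'I_n) : coord_mx g a b = coord e a (g e`_b).
Proof. by rewrite !mxE /= vecof_delta. Qed.

Lemma coord_mx_inv (g : SL V) :
  coord_mx (val g) *m coord_mx (val g)^-1%VF = 1%:M /\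
  coord_mx (val g)^-1%VF *m coord_mx (val g) = 1%:M.
Proof.
have gU := SL_lker0 g.
split; rewrite -trmx_mul -end_mx_comp ?(lker0_compVf gU) ?(lker0_compfV gU);
by rewrite end_mx1 trmx1.
Qed.

Lemma tensor_coords_act (g : 'End(V)) w :
  tensor_coords (tens_act g (tensor_of_coords w)) =
  act_coords (coord_mx g) (coord_mx g^-1%VF) w.
Proof.
apply/ffunP => -[A B]; rewrite ffunE act_coordsE /tens_act /tensor_of_coords /=.
apply: eq_bigr => A' _; apply: eq_bigr => B' _; rewrite mulrC; congr (_ * _).
rewrite /basis_mono big_split /mono; congr (_ * _); apply: eq_bigr => i _.
  by rewrite comp_lfunE dual_basisE coord_mxE.
by rewrite coord_mxE.
Qed.

(** Dividing [g] by an [n]-th root of its determinant does not change its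
    action, since vector and covector slots are equally many. *)
Lemma act_coords_SL (g h : 'M[C]_n) : (0 < n)%N -> g *m h = 1%:M ->
  exists x : SL V, forall w,
    act_coords (coord_mx (val x)) (coord_mx (val x)^-1%VF) w = act_coords g h w.
Proof.
move=> n_gt0 gh; have [g_unit _] := mulmx1_unit gh.
pose c := n.-root (\det g).
have c_neq0 : c != 0 by rewrite rootC_eq0 // -unitfE -unitmxE.
pose x : 'End(V) := hommx e e (c^-1 *: g)^T.
have e_basis := vbasis_fullvP V.
have xE : end_mx x = (c^-1 *: g)^T by rewrite /end_mx hommxK.
have x_det : end_det x == 1.
  rewrite /end_det xE det_tr detZ exprVn rootCK // mulVf //.
  by rewrite -unitfE -unitmxE.
exists (exist _ x x_det) => w /=.
have x_mx : coord_mx x = c^-1 *: g by rewrite /coord_mx xE trmxK.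
have xV_mx : coord_mx x^-1%VF = c *: h.
  have [/= xxV _] := coord_mx_inv (exist _ x x_det).
  have chg : (c *: h) *m (c^-1 *: g) = 1%:M.
    by rewrite -scalemxAl -scalemxAr scalerA divff // scale1r (mulmx1C gh).
  by rewrite -[LHS]mul1mx -chg -mulmxA -x_mx xxV mulmx1.
apply/ffunP => -[A B]; rewrite !act_coordsE x_mx xV_mx.
apply: eq_bigr => A' _; apply: eq_bigr => B' _; congr (_ * _).
by rewrite !mono_scale mulrACA -exprMn mulVf // expr1n mul1r.
Qed.

Definition S0_coords u : coords := tensor_coords (val u).
Definition S0_of_coords w : S0 V k := insubd 0 (tensor_of_coords w).

Lemma S0_sym0_sl u : sym0_sl (val u).
Proof. exact/asboolP/(valP u). Qed.

Lemma S0_coords_in u : in_S0_coords (S0_coords u).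
Proof. exact/sym0_sl_coords/S0_sym0_sl. Qed.

Lemma val_S0_of_coords w :
  in_S0_coords w -> val (S0_of_coords w) = tensor_of_coords w.
Proof.
by move=> w_in; rewrite insubdK //; apply/asboolP/sym0_sl_of_coords.
Qed.

Lemma S0_coordsK : cancel S0_coords S0_of_coords.
Proof.
move=> u; apply: val_inj; rewrite val_S0_of_coords; last exact: S0_coords_in.
by apply: tensor_coordsK; have [[]] := S0_sym0_sl u.
Qed.

Lemma S0_of_coordsK w : in_S0_coords w -> S0_coords (S0_of_coords w) = w.
Proof. by move=> w_in; rewrite /S0_coords val_S0_of_coords // tensor_of_coordsK. Qed.

Lemma S0_coords_linear : linear S0_coords.
Proof. by move=> c u v; rewrite -tensor_coords_linear. Qed.

Lemma S0_of_coords_linear c w1 w2 : in_S0_coords w1 -> in_S0_coords w2 ->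
  S0_of_coords (c *: w1 + w2) = c *: S0_of_coords w1 + S0_of_coords w2.
Proof.
move=> w1_in w2_in; apply: (can_inj S0_coordsK).
by rewrite S0_coords_linear !S0_of_coordsK //; apply: in_S0_coordsP.
Qed.

Lemma S0_coords_act (g : SL V) u :
  S0_coords (S0_act g u) =
  act_coords (coord_mx (val g)) (coord_mx (val g)^-1%VF) (S0_coords u).
Proof.
rewrite -tensor_coords_act /S0_coords tensor_coordsK //.
by have [[]] := S0_sym0_sl u.
Qed.

End SLAction.

(** * The group algebra and its centre *)

Section PermuteCoords.
Variables (C : numClosedFieldType) (k n : nat).
Local Notation idx := {ffun 'I_k -> 'I_n}.
Local Notation coords := {ffun idx * idx -> C^o}.
Implicit Types (A B : idx) (t u w : coords) (g h : 'M[C]_n) (d : 'S_k -> C).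

Lemma permute_coordsE d t A B :
  permute_coords d t (A, B) = \sum_s d s * t (relabel A s, B).
Proof. by rewrite ffunE. Qed.

Lemma permute_coords_linear d : linear (permute_coords d : coords -> coords).
Proof.
move=> c t u; apply/ffunP => -[A B]; rewrite !ffunE /= scaler_sumr -big_split.
apply: eq_bigr => s _ /=; rewrite !ffunE mulrDr; congr (_ + _); exact: mulrCA.
Qed.

(** Conjugation invariance of [d] is what makes the symmetry survive. *)
Lemma permute_coords_in d t : (forall s r, d (s ^ r)%g = d s) ->
  in_S0_coords t -> in_S0_coords (permute_coords d t).
Proof.
move=> d_class [t_sym t0]; split=> [x A B|p q A B].
  rewrite !permute_coordsE [RHS](reindex_inj (conjg_inj x)) /=.
  apply: eq_bigr => s _; rewrite d_class -[in RHS](t_sym x) !relabelM.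
  by rewrite conjgE !mulgA mulgV mul1g.
under eq_bigr => a _ do rewrite permute_coordsE.
rewrite exchange_big big1 //= => s _.
rewrite -mulr_sumr -[RHS](mulr0 (d s)); congr (_ * _).
rewrite -[RHS](t0 (s^-1 p)%g q (relabel A s) B); apply: eq_bigr => a _.
congr (t (_, _)); apply/ffunP => i; rewrite !ffunE.
by rewrite (canF_eq (permK s)).
Qed.

Lemma permute_coords_comp d1 d2 t A B :
  permute_coords d1 (permute_coords d2 t) (A, B) =
  \sum_s \sum_r d1 s * d2 r * t (relabel A (r * s)%g, B).
Proof.
rewrite permute_coordsE; apply: eq_bigr => s _.
rewrite permute_coordsE mulr_sumr; apply: eq_bigr => r _.
by rewrite relabelM mulrA.
Qed.

Lemma act_permute_coords g h d t :
  act_coords g h (permute_coords d t) = permute_coords d (act_coords g h t).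
Proof.
apply/ffunP => -[A B]; rewrite act_coordsE permute_coordsE.
transitivity (\sum_A' \sum_B' \sum_s
    d s * (mono g A A' * mono h B' B * t (relabel A' s, B'))).
  apply: eq_bigr => A' _; apply: eq_bigr => B' _.
  by rewrite permute_coordsE mulr_sumr; apply: eq_bigr => s _; rewrite mulrCA.
under eq_bigr => A' _ do rewrite exchange_big.
rewrite exchange_big; apply: eq_bigr => s _ /=.
rewrite act_coordsE [in RHS](reindex_inj (can_inj (relabelK s))) mulr_sumr /=.
apply: eq_bigr => A' _; rewrite mulr_sumr; apply: eq_bigr => B' _.
by rewrite mono_relabel.
Qed.

(** The test tensor is the symmetrisation of the tensor product of the
    [e_(iota (inl i)) (x) e_(iota (inr i))^*].  It is trace-free because [iota]
    takes different values on the two blocks. *)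
Lemma permute_coords_injective (iota : {ffun ('I_k + 'I_k)%type -> 'I_n}) d1 d2 :
    injective iota ->
    (forall t, in_S0_coords t -> permute_coords d1 t = permute_coords d2 t) ->
  d1 =1 d2.
Proof.
move=> iota_inj d12 s0.
pose A0 := lpart iota; pose B0 := rpart iota.
pose t : coords :=
  [ffun x => \sum_(r : 'S_k) ((x.1 == relabel A0 r) && (x.2 == relabel B0 r))%:R].
have t_in : in_S0_coords t.
  split=> [s A B|p q A B].
    rewrite !ffunE /= (reindex_inj (mulgI s)); apply: eq_bigr => r _.
    by rewrite -!relabelM !(inj_eq (can_inj (relabelK s))).
  apply: big1 => a _; rewrite ffunE /= big1 // => r _.
  case: eqP => // /ffunP/(_ p); rewrite upd_same !ffunE => ap.
  case: eqP => // /ffunP/(_ q); rewrite upd_same !ffunE ap => /iota_inj.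
  by [].
have relabel_inj (E : idx) s r : injective E -> (relabel E s == relabel E r) = (s == r).
  move=> E_inj; apply/eqP/eqP => [/ffunP e|-> //]; apply/permP => i.
  by have := e i; rewrite !ffunE => /E_inj.
have A0_inj : injective A0 by move=> i j; rewrite !ffunE => /iota_inj [].
have B0_inj : injective B0 by move=> i j; rewrite !ffunE => /iota_inj [].
have B0_eq r : (B0 == relabel B0 r) = (1%g == r).
  by rewrite -{1}(relabel1 B0) relabel_inj.
have dE d : permute_coords d t (relabel A0 s0^-1, B0) = d s0.
  rewrite permute_coordsE (bigD1 s0) //= big1 ?addr0 => [|s s_neq].
    rewrite relabelM mulgV ffunE /= (bigD1 1%g) //= big1 ?addr0 => [|r r_neq].
      by rewrite !relabel1 !eqxx mulr1.
    by rewrite relabel_inj // eq_sym (negPf r_neq).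
  rewrite relabelM ffunE /= big1 ?mulr0 // => r _.
  rewrite B0_eq relabel_inj //; case: eqP => // <-.
  by rewrite eq_sym -eq_mulgV1 (negPf s_neq).
by have := congr1 (fun w : coords => w (relabel A0 s0^-1, B0)) (d12 t t_in); rewrite !dE.
Qed.

End PermuteCoords.

Section GroupRing.
Variables (F : fieldType) (gT : finGroupType).
Local Notation G := [set: gT]%G.
Local Notation R_G := (group_ring F G).
Local Notation aG := (regular_repr F G).
Implicit Types (x y : 'M[F]_(gcard G)) (s r : gT).

(** In the regular representation the row of index 1 of [s] is the unit vector of
    index [s]; so this row lists the coefficients of [x]. *)
Definition gring_coef x s : F := x (gring_index G 1) (gring_index G s).

Lemma gring_coef_regular s r : gring_coef (aG s) r = (s == r)%:R.
Proof.
rewrite /gring_coef !mxE gring_indexK ?inE // mul1g eqxx /=.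
by rewrite (can_in_eq (@gring_indexK _ G)) ?inE // eq_sym.
Qed.

Lemma gring_coef_sum I (q : seq I) (c : I -> F) (z : I -> 'M[F]_(gcard G)) s :
  gring_coef (\sum_(i <- q) c i *: z i) s = \sum_(i <- q) c i * gring_coef (z i) s.
Proof. by rewrite /gring_coef summxE; apply: eq_bigr => i _; rewrite mxE. Qed.

Lemma gring_sum_coef x : (x \in R_G)%MS -> x = \sum_s gring_coef x s *: aG s.
Proof.
move=> /envelop_mxP [c ->]; rewrite (eq_bigl xpredT) => [|s]; last by rewrite inE.
apply: eq_bigr => s _; rewrite gring_coef_sum (bigD1 s) //= big1 ?addr0.
  by rewrite gring_coef_regular eqxx mulr1.
by move=> r /negPf neq; rewrite gring_coef_regular neq mulr0.
Qed.

Lemma gring_coef_expansion (c : gT -> F) s : gring_coef (\sum_r c r *: aG r) s = c s.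
Proof.
rewrite gring_coef_sum (bigD1 s) //= big1 ?addr0.
  by rewrite gring_coef_regular eqxx mulr1.
by move=> r /negPf neq; rewrite gring_coef_regular neq mulr0.
Qed.

Lemma regular_mul s r : aG s *m aG r = aG (s * r)%g.
Proof. by rewrite repr_mxM ?inE. Qed.

Lemma gring_coef_mul x y (V : lmodType F) (f : gT -> V) :
    (x \in R_G)%MS -> (y \in R_G)%MS ->
  \sum_s gring_coef (x *m y) s *: f s =
  \sum_s \sum_r (gring_coef x s * gring_coef y r) *: f (s * r)%g.
Proof.
move=> x_in y_in.
have -> : x *m y = \sum_(p : gT * gT)
    (gring_coef x p.1 * gring_coef y p.2) *: aG (p.1 * p.2)%g.
  rewrite -(pair_big xpredT xpredT
    (fun s r => (gring_coef x s * gring_coef y r) *: aG (s * r)%g)) /=.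
  rewrite {1}(gring_sum_coef x_in) {1}(gring_sum_coef y_in) mulmx_suml.
  apply: eq_bigr => s _; rewrite mulmx_sumr; apply: eq_bigr => r _.
  by rewrite -scalemxAl -scalemxAr scalerA regular_mul.
under eq_bigr => s _ do rewrite gring_coef_sum scaler_suml.
rewrite exchange_big [RHS]pair_big /=; apply: eq_bigr => -[s r] _ /=.
rewrite (bigD1 (s * r)%g) //= big1 ?addr0.
  by rewrite gring_coef_regular eqxx mulr1.
by move=> q /negPf neq; rewrite gring_coef_regular eq_sym neq mulr0 scale0r.
Qed.

Lemma center_gring_coefP x : (x \in 'Z(R_G))%MS ->
  (x \in R_G)%MS /\ forall s r, gring_coef x (s ^ r)%g = gring_coef x s.
Proof.
move=> /center_mxP [x_in x_comm]; split=> // s r.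
have r_in : (aG r \in R_G)%MS by apply: envelop_mx_id; rewrite inE.
have := congr1 (gring_coef^~ (s * r)%g) (x_comm (aG r) r_in).
rewrite {1 2}(gring_sum_coef x_in) mulmx_sumr mulmx_suml.
under eq_bigr => q _ do rewrite -scalemxAr regular_mul.
under [in RHS]eq_bigr => q _ do rewrite -scalemxAl regular_mul.
rewrite !gring_coef_sum (bigD1 (s ^ r)%g) //= [X in _ + X]big1 => [|q q_neq].
  rewrite addr0 gring_coef_regular conjgE !mulgA mulgV mul1g eqxx mulr1 => ->.
  rewrite (bigD1 s) //= [X in _ + X]big1 ?addr0 => [|q /negPf q_neq].
    by rewrite gring_coef_regular eqxx mulr1.
  by rewrite gring_coef_regular (inj_eq (mulIg r)) q_neq mulr0.
rewrite gring_coef_regular; case: eqP => [e|]; last by rewrite mulr0.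
by case/eqP: q_neq; rewrite conjgE -e mulKg.
Qed.

Lemma class_function_center (d : gT -> F) : (forall s r, d (s ^ r)%g = d s) ->
  (\sum_s d s *: aG s \in 'Z(R_G))%MS.
Proof.
move=> d_class; apply/center_mxP; split.
  by apply/envelop_mxP; exists d; apply: eq_bigl => s; rewrite inE.
move=> y y_in; rewrite (gring_sum_coef y_in) mulmx_suml mulmx_sumr.
apply: eq_bigr => r _; rewrite -scalemxAl -scalemxAr; congr (_ *: _).
rewrite mulmx_sumr mulmx_suml (reindex_inj (conjg_inj r)); apply: eq_bigr => s _.
rewrite d_class -scalemxAl -scalemxAr !regular_mul; congr (_ *: aG _).
by rewrite conjgE !mulgA mulgV mul1g.
Qed.

End GroupRing.

(** * The isomorphism *)

Section AlgebraIsomorphism.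
Variables (C : numClosedFieldType) (V : vectType C) (k : nat).
Hypotheses (k_gt0 : (0 < k)%N) (dimV_ge : (2 * k <= \dim {:V})%N).
Local Notation n := (\dim {:V}).
Local Notation idx := {ffun 'I_k -> 'I_n}.
Local Notation coords := {ffun idx * idx -> C^o}.
Local Notation G := [set: 'S_k]%G.
Local Notation Z := (center_group_ring C k).
Implicit Types (x y : 'M[C]_(gcard G)) (u : S0 V k) (d : 'S_k -> C).

Lemma slots_embed : exists iota : {ffun ('I_k + 'I_k)%type -> 'I_n}, injective iota.
Proof.
have slots_n : (#|{: 'I_k + 'I_k}| <= n)%N.
  by rewrite card_sum card_ord addnn -mul2n.
exists [ffun i => widen_ord slots_n (enum_rank i)] => i j; rewrite !ffunE.
by move/(congr1 val) => /= /ord_inj /enum_rank_inj.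
Qed.

Lemma eq_permute_coords d1 d2 (t : coords) :
  d1 =1 d2 -> permute_coords d1 t = permute_coords d2 t.
Proof.
by move=> d12; apply/ffunP => z; rewrite !ffunE; apply: eq_bigr => s _; rewrite d12.
Qed.

Definition center_action x u : S0 V k :=
  S0_of_coords (permute_coords (gring_coef x) (S0_coords u)).

Lemma S0_coords_center_action x u : Z x ->
  S0_coords (center_action x u) = permute_coords (gring_coef x) (S0_coords u).
Proof.
move=> /center_gring_coefP [_ x_class]; apply: S0_of_coordsK.
by apply: permute_coords_in; last exact: S0_coords_in.
Qed.

Lemma center_action_equivariant x : Z x -> End_SL_S0 V k (center_action x).
Proof.
move=> xZ; split=> [c u v|g u]; apply: (can_inj (@S0_coordsK _ _ _)).
  rewrite S0_coords_linear !S0_coords_center_action // S0_coords_linear.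
  exact: permute_coords_linear.
by rewrite S0_coords_act !S0_coords_center_action // S0_coords_act act_permute_coords.
Qed.

Lemma center_action_injective x y :
  Z x -> Z y -> center_action x = center_action y -> x = y.
Proof.
move=> xZ yZ xy; have [iota iota_inj] := slots_embed.
have [[x_in _] [y_in _]] := (center_gring_coefP xZ, center_gring_coefP yZ).
rewrite (gring_sum_coef x_in) (gring_sum_coef y_in); apply: eq_bigr => s _.
congr (_ *: _); move: s; apply: (permute_coords_injective iota_inj) => t t_in.
have := congr1 (fun f => S0_coords (f (@S0_of_coords C V k t))) xy.
by rewrite /= !S0_coords_center_action // S0_of_coordsK.
Qed.

Lemma center_action_surjective f :
  End_SL_S0 V k f -> exists2 x, Z x & center_action x = f.
Proof.
move=> [f_lin f_SL]; have [iota iota_inj] := slots_embed.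
have n_gt0 : (0 < n)%N by apply: leq_trans dimV_ge; rewrite muln_gt0.
pose fc (t : coords) := S0_coords (f (@S0_of_coords C V k t)).
have fc_lin c t w : in_S0_coords t -> in_S0_coords w ->
    fc (c *: t + w) = c *: fc t + fc w.
  by move=> t_in w_in; rewrite /fc S0_of_coords_linear // f_lin S0_coords_linear.
have fc_in t : in_S0_coords t -> in_S0_coords (fc t) by move=> _; exact: S0_coords_in.
have fc_act g h t : g *m h = 1%:M -> h *m g = 1%:M -> in_S0_coords t ->
    fc (act_coords g h t) = act_coords g h (fc t).
  move=> gh _ t_in; have [x xE] := act_coords_SL k n_gt0 gh.
  rewrite -!xE -S0_coords_act -f_SL /fc; congr (S0_coords (f _)).
  apply: (can_inj (@S0_coordsK _ _ _)); rewrite S0_coords_act !S0_of_coordsK //.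
  by apply: act_coords_in => //; have [] := coord_mx_inv x.
have [d [d_class dE]] := commutant_class_function fc_lin fc_in fc_act iota_inj.
have dZ := class_function_center d_class.
exists (\sum_s d s *: regular_repr C G s) => //.
apply/funext => u; apply: (can_inj (@S0_coordsK _ _ _)).
rewrite S0_coords_center_action // (eq_permute_coords _ (gring_coef_expansion d)).
by rewrite -dE ?/fc ?S0_coordsK //; exact: S0_coords_in.
Qed.

Lemma center_action_linear c x y : Z x -> Z y ->
  center_action (c *: x + y) = c *: center_action x + center_action y.
Proof.
move=> xZ yZ; apply/funext => u; apply: (can_inj (@S0_coordsK _ _ _)).
have xyZ : Z (c *: x + y).
  rewrite /center_group_ring /= linearP /=.
  by apply: addmx_sub => //; apply: scalemx_sub.
rewrite -[RHS]/(S0_coords (c *: center_action x u + center_action y u)).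
rewrite S0_coords_linear !S0_coords_center_action //.
apply/ffunP => -[A B]; rewrite !ffunE /= scaler_sumr -big_split.
by apply: eq_bigr => s _; rewrite /gring_coef !mxE mulrDl -mulrA.
Qed.

(** Permuting slots is an action of the opposite group algebra; on the centre the
    order of the factors is irrelevant. *)
Lemma center_action_mul x y : Z x -> Z y ->
  center_action (x *m y) = center_action x \o center_action y.
Proof.
move=> xZ yZ; have [x_in x_comm] := center_mxP xZ; have [y_in _] := center_mxP yZ.
have xyZ : Z (x *m y).
  rewrite /center_group_ring /=; apply/center_mxP; split.
    by apply: envelop_mxM.
  move=> z z_in; have [_ y_comm] := center_mxP yZ.
  by rewrite mulmxA x_comm // -mulmxA y_comm // mulmxA.
apply/funext => u; apply: (can_inj (@S0_coordsK _ _ _)).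
rewrite /= !S0_coords_center_action // -(x_comm y y_in).
apply/ffunP => -[A B]; rewrite permute_coords_comp permute_coordsE.
transitivity (\sum_s gring_coef (y *m x) s *:
  (S0_coords u (relabel A s, B) : C^o)) => //.
rewrite (gring_coef_mul _ y_in x_in) exchange_big.
by apply: eq_bigr => s _; apply: eq_bigr => r _; rewrite [gring_coef x s * _]mulrC.
Qed.

Lemma center_action1 : center_action 1%:M = id.
Proof.
have oneE s : gring_coef (1%:M : 'M[C]_(gcard G)) s = (s == 1%g)%:R.
  by rewrite -(repr_mx1 (regular_repr C G)) gring_coef_regular eq_sym.
apply/funext => u; rewrite /center_action -[RHS]S0_coordsK; congr (S0_of_coords _).
apply/ffunP => -[A B]; rewrite permute_coordsE (bigD1 1%g) //= big1 ?addr0.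
  by rewrite oneE eqxx mul1r relabel1.
by move=> s /negPf neq; rewrite oneE neq mul0r.
Qed.

Lemma center_action_algebra_iso : is_algebra_iso center_action.
Proof.
split.
- split; first exact: center_action_equivariant.
    by move=> x y /set_mem xZ /set_mem yZ; exact: center_action_injective.
  by move=> f /center_action_surjective.
- by move=> c x y /set_mem xZ /set_mem yZ; exact: center_action_linear.
- by move=> x y /set_mem xZ /set_mem yZ; exact: center_action_mul.
- exact: center_action1.
Qed.

End AlgebraIsomorphism.

Theorem theorem5p4 (R : realType) (k : nat) (V : vectType R[i])
    (k_ge1 : (1 <= k)%N) (dimV_ge : (2 * k <= \dim {:V})%N) :
  exists phi : 'M[R[i]]_(gcard [set: 'S_k]%G) -> (S0 V k -> S0 V k),
    is_algebra_iso phi.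
Proof.
exists (@center_action _ V k).
exact: center_action_algebra_iso.
Qed.
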